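(* Let $G$ be a finitely generated group having a surjective homomorphism $\chi:G\to\mathbb{Z}$ whose kernel is not finitely generated. Then $\omega(G)\geq 2^{1/4}$.
   Context: For a finitely generated group $G$ and a finite generating set $A$ of $G$, let $\gamma_A(n)$ be the number of elements of $G$ of word length at most $n$ with respect to $A\cup A^{-1}$, and let $\omega(G,A)=\lim_{n\to\infty}\gamma_A(n)^{1/n}$ (the limit exists since $\gamma_A$ is submultiplicative). The growth constant of $G$ is $\omega(G)=\inf_A \omega(G,A)$, the infimum being over all finite generating sets $A$ of $G$. *)

(* Defs.v *)
From HB Require Import structures.
From mathcomp Require Export all_boot all_order all_algebra finmap.
From mathcomp Require Export all_classical all_reals all_analysis.

Set Implicit Arguments.
Unset Strict Implicit.
Unset Printing Implicit Defensive.

Export Order.TTheory GRing.Theory Num.Theory.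
Export numFieldNormedType.Exports.

Local Open Scope classical_set_scope.
Local Open Scope ring_scope.

Definition letters (G : groupType) (A : set G) : set G :=
  A `|` [set x^-1%g | x in A].

Definition evaluates_to (G : groupType) (A : set G) (s : seq G) (x : G) : Prop :=
  (forall y, y \in s -> letters A y) /\ (\prod_(y <- s) y)%g = x.

Definition generated_subgroup (G : groupType) (A : set G) : set G :=
  [set x | exists s, evaluates_to A s x].

Definition finitely_generated (G : groupType) (H : set G) : Prop :=
  exists A : set G, finite_set A /\ generated_subgroup A = H.

Definition finite_generating_set (G : groupType) (A : set G) : Prop :=
  finite_set A /\ generated_subgroup A = [set: G].

Definition word_ball (G : groupType) (A : set G) (n : nat) : set G :=
  [set x | exists s, evaluates_to A s x /\ (size s <= n)%N].

(* fset_set is fset0 on infinite sets; word_ball_finite below shows that this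
   default value is never used for finite A. *)
Definition growth (G : groupType) (A : set G) (n : nat) : nat :=
  #|` fset_set (word_ball A n)|.

Definition growth_rate (R : realType) (G : groupType) (A : set G) : R :=
  limn (fun n : nat => (growth A n)%:R `^ (n%:R^-1) : R).

(* limn is total; for finite A the limit exists because growth A is
   submultiplicative.  The infimum is taken in R: for finitely generated G the
   set is nonempty, and 1 is a lower bound since every ball contains 1. *)
Definition growth_constant (R : realType) (G : groupType) : R :=
  inf [set growth_rate R A | A in @finite_generating_set G].

Lemma word_ball_finite (G : groupType) (A : set G) (n : nat) :
  finite_set A -> finite_set (word_ball A n).
Proof.
move=> finA; have finL : finite_set (letters A).
  by rewrite finite_setU; split=> //; exact: finite_image.
elim: n => [|n IHn].
  apply: (@sub_finite_set _ _ [set 1%g]); last exact: finite_set1.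
  by move=> x [[|y s] [[_ <-] //] _]; rewrite big_nil.
apply: (@sub_finite_set _ _
  ([set 1%g] `|` [set (a * b)%g | a in letters A & b in word_ball A n])).
  move=> x [[|y s] [[Ls <-] sz]]; first by left; rewrite big_nil.
  right; exists y; first by apply: Ls; rewrite mem_head.
  exists (\prod_(y <- s) y)%g; last by rewrite big_cons.
  exists s; split=> //; split=> // z zs.
  by apply: Ls; rewrite in_cons zs orbT.
by rewrite finite_setU; split; [exact: finite_set1|exact: finite_image2].
Qed.

(* Main.v *)
Require Import Defs.
From mathcomp Require Import all_boot all_order all_algebra.
From mathcomp Require Import all_classical all_reals all_analysis.
From mathcomp Require Import zify ring.

(**
Let A generate G, choose t in A with chi t <> 0, and let a be a letter.  If the
positive words in t and t ^ a of each given length are pairwise distinct, then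
the ball of radius 3n has at least 2^n elements, so that the growth rate is at
least 2^(1/3).  Otherwise, as in Milnor's lemma, a coincidence between two such
words provides a finite set B in ker chi such that <B> is normalised by t and
contains [t, a].

Suppose that this occurs for every letter a, and let B be the union of these
sets.  Since t ^ a lies in t<B>, the subgroup generated by B and B^a is again
normalised by t.  Iterating along a word x gives, for each x in G, a finite set
B in ker chi such that <B> is normalised by t and contains [t, x].  Since the
subgroup generated by ker chi and t has finite index, there is a finite set C in
ker chi such that the conjugates of C by powers of t generate ker chi
(Schreier).  Adding C to the union of the sets B obtained for x in C then gives
a finite generating set of ker chi.
*)

Set Implicit Arguments.
Unset Strict Implicit.
Unset Printing Implicit Defensive.

Local Open Scope classical_set_scope.
Local Open Scope ring_scope.

(** * Generated subgroups and generating sets normalised by an element *)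

Section GeneratedSubgroup.
Context {G : groupType}.
Implicit Types (B C : set G) (x y t a : G).

Local Notation "<< B >>" := (generated_subgroup B).

Definition is_subgroup (H : set G) : Prop :=
  [/\ H 1%g, forall x y, H x -> H y -> H (x * y)%g & forall x, H x -> H x^-1%g].

Lemma gen_subgroup B : is_subgroup << B >>.
Proof.
split.
- by exists [::]; split; rewrite ?big_nil.
- move=> x y [s [Ls <-]] [s' [Ls' <-]]; exists (s ++ s'); split; last first.
    by rewrite big_cat.
  by move=> z; rewrite mem_cat => /orP[/Ls|/Ls'].
- move=> x [s [Ls <-]]; exists (rev [seq y^-1%g | y <- s]); split.
    move=> z; rewrite mem_rev => /mapP[y /Ls [By|[w Bw <-]] ->].
      by right; exists y.
    by left; rewrite invgK.
  elim: s {Ls} => [|y s IH]; first by rewrite !big_nil invg1.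
  by rewrite big_cons invgM -IH /= rev_cons -cats1 big_cat /= big_seq1.
Qed.

Lemma gen_sub B x : B x -> << B >> x.
Proof.
move=> Bx; exists [:: x]; split; rewrite ?big_seq1// => y.
by rewrite inE => /eqP ->; left.
Qed.

Lemma gen_min B (H : set G) : is_subgroup H -> B `<=` H -> << B >> `<=` H.
Proof.
move=> [H1 HM HV] BH x [s [+ <-]].
elim: s => [|y s IH] Ls; first by rewrite big_nil.
rewrite big_cons; apply: HM.
  by have [/BH//|[z /BH/HV + <-]] := Ls y (mem_head _ _).
by apply: IH => z zs; apply: Ls; rewrite inE zs orbT.
Qed.

Lemma gen_mono B C : B `<=` C -> << B >> `<=` << C >>.
Proof. by move=> BC; apply: gen_min (gen_subgroup C) _ => x /BC/gen_sub. Qed.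

Lemma gen_conj B x y : << B >> x -> << B >> y -> << B >> (x ^ y)%g.
Proof.
have [_ M V] := gen_subgroup B => Bx By.
by rewrite conjgE; apply: M (V _ By) (M _ _ Bx By).
Qed.

Lemma gen_image_conj B C a x :
  (forall b, B b -> << C >> (b ^ a)%g) -> << B >> x -> << C >> (x ^ a)%g.
Proof.
have [C1 CM CV] := gen_subgroup C => BC.
move: x; apply: (@gen_min B [set x | << C >> (x ^ a)%g]) => //; split=> /=.
- by rewrite conj1g.
- by move=> x y xC yC; rewrite conjMg; exact: CM.
- by move=> x xC; rewrite conjVg; exact: CV.
Qed.

(** Both signs are required: conjugation by [t] alone may map [<< B >>] properly into itself. *)
Definition normalises (t : G) (B : set G) : Prop :=
  forall b, B b -> << B >> (b ^ t)%g /\ << B >> (b ^ t^-1)%g.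

Lemma normalisesJ t B x : normalises t B -> << B >> x -> << B >> (x ^ t)%g.
Proof. by move=> nB; apply: gen_image_conj => b /nB[]. Qed.

Lemma normalisesJV t B x : normalises t B -> << B >> x -> << B >> (x ^ t^-1)%g.
Proof. by move=> nB; apply: gen_image_conj => b /nB[]. Qed.

Lemma normalises_bigcup (I : Type) (D : set I) t (B : I -> set G) :
  (forall i, D i -> normalises t (B i)) -> normalises t (\bigcup_(i in D) B i).
Proof.
move=> nB b [i Di Bib]; have [b1 b2] := nB i Di b Bib.
by split; [move: b1|move: b2]; apply: gen_mono => x ?; exists i.
Qed.

(** Both conjugates of [c] equal [c] times an element of [<< B >>], namely [[~ t, c]^-1] for [t] and
    [[~ t, c] ^ t^-1] for [t^-1]. *)
Lemma normalises_adjoin t B C : normalises t B ->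
  (forall c, C c -> << B >> [~ t, c]%g) -> normalises t (B `|` C).
Proof.
move=> nB tC; have [_ M V] := gen_subgroup (B `|` C).
have BBC : << B >> `<=` << B `|` C >> by apply: gen_mono; exact: subsetUl.
move=> b [Bb|Cb]; first by have [? ?] := nB b Bb; split; exact: BBC.
have gb : << B `|` C >> b by apply: gen_sub; right.
have -> : (b ^ t = b * [~ t, b]^-1)%g by rewrite invgR commgEl mulVKg.
have -> : (b ^ t^-1 = b * [~ t, b] ^ t^-1)%g.
  by rewrite commgEl !conjgE !invgK !mulgA mulgK mulgV mul1g.
split; apply: M => //; first by apply: V; apply: BBC; exact: tC.
by apply: BBC; apply: normalisesJV => //; exact: tC.
Qed.

(** As [a * t = t * a * [~ t, a]^-1], conjugating [c ^ a] by [t] gives [(c ^ t) ^ a] up to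
    conjugation by an element of [<< B >>]; likewise for [t^-1]. *)
Lemma normalises_conj t a B : normalises t B -> << B >> [~ t, a]%g ->
  normalises t (B `|` [set b ^ a | b in B]%g).
Proof.
set B' := B `|` _ => nB tB.
have BB' : << B >> `<=` << B' >> by apply: gen_mono; exact: subsetUl.
have BaB' x : << B >> x -> << B' >> (x ^ a)%g.
  by apply: gen_image_conj => b Bb; apply: gen_sub; right; exists b.
move=> b [Bb|[c Bc <-]].
  by have [? ?] := nB b Bb; split; exact: BB'.
have gc := gen_sub Bc.
have [_ _ V] := gen_subgroup B.
have -> : ((c ^ a) ^ t = ((c ^ t) ^ a) ^ [~ t, a]^-1)%g.
  rewrite -!conjgM; congr (_ ^ _)%g.
  by rewrite invgR mulgA -commgC.
have -> : ((c ^ a) ^ t^-1 = ((c ^ t^-1) ^ a) ^ ([~ t, a] ^ t^-1))%g.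
  rewrite -!conjgM; congr (_ ^ _)%g.
  by rewrite commgEl !conjgE !invgK !mulgA !mulgK mulVg mul1g.
split; apply: gen_conj.
- by apply: BaB'; exact: normalisesJ.
- by apply: BB'; exact: V.
- by apply: BaB'; exact: normalisesJV.
- by apply: BB'; exact: normalisesJV.
Qed.

End GeneratedSubgroup.

(** * Milnor's lemma on coincidences between positive words *)

Section Milnor.
Context {G : groupType} (t y : G).
Local Notation "<< B >>" := (generated_subgroup B).

(** The letters are [t] and [t * y]; for [y = [~ t, a]] the second is [t ^ a]. *)
Definition milnor_word (e : seq bool) : G := (\prod_(b <- e) (t * y ^+ (b : nat)))%g.

Definition conj_powers (m : nat) : set G := [set (y ^ (t ^+ i))%g | i in `I_m].

(* Milnor's normal form: p e is a product of conjugates y ^ (t ^+ i) with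
   distinct i < size e. *)
Let p (e : seq bool) : G := (t ^- size e * milnor_word e)%g.

Let p_cons b e : p (b :: e) = ((y ^+ b) ^ (t ^+ size e) * p e)%g.
Proof.
by rewrite /p /milnor_word big_cons /= expgS conjgE invgM !mulgA mulgK mulgVK.
Qed.

Let p_rcons b e : p (rcons e b) = (p e ^ t * y ^+ b)%g.
Proof.
rewrite /p /milnor_word -cats1 big_cat big_seq1 size_cat addn1 /= expgSr invgM.
by rewrite conjgE !mulgA.
Qed.

Let p_in e : << conj_powers (size e) >> (p e).
Proof.
elim: e => [|b e IH].
  rewrite /p /milnor_word big_nil invg1 mulg1.
  by case: (gen_subgroup (conj_powers 0)).
have [X1 M _] := gen_subgroup (conj_powers (size e).+1).
rewrite p_cons /=; apply: M.
  rewrite conjXg.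
  by case: b => //=; apply: gen_sub; exists (size e) => /=.
by apply: gen_mono IH => _ [i /= ie <-]; exists i => //=; exact: ltnW.
Qed.

(** In a shortest coincidence, of length [m.+1], comparing first letters expresses [y ^ (t ^+ m)]
    through the conjugates of index below [m], and comparing last letters does so for [y ^ t^-1]. *)
Lemma milnor_normal e f : e != f -> size e = size f ->
  milnor_word e = milnor_word f ->
  exists m, normalises t (conj_powers m) /\ << conj_powers m >> y.
Proof.
move=> ef sz w.
(* In a shortest coincidence both the first and the last letters differ. *)
pose P n := `[< exists e1 f1, [/\ size e1 = n, size f1 = n, e1 != f1 &
  milnor_word e1 = milnor_word f1] >].
have exP : exists n, P n by exists (size e); apply/asboolP; exists e, f.
case: (ex_minnP exP) => n /asboolP[e' [f' [sze szf nef we]]] minn.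
have mn k (e1 f1 : seq bool) : size e1 = k -> size f1 = k -> e1 != f1 ->
    milnor_word e1 = milnor_word f1 -> (n <= k)%N.
  by move=> *; apply: minn; apply/asboolP; exists e1, f1.
have pe : p e' = p f' by rewrite /p sze szf we.
case: n sze szf mn {minn} => [|m] sze szf mn.
  by move: nef; rewrite (size0nil sze) (size0nil szf) eqxx.
exists m.
have [X1 M V] := gen_subgroup (conj_powers m).
have top : << conj_powers m >> (y ^ (t ^+ m))%g.
  case: e' f' sze szf nef we pe => [|b e'] [|c f'] //= [sze] [szf] nef we pe.
  have pin := p_in e'; have qin := p_in f'; rewrite sze in pin; rewrite szf in qin.
  case: (eqVneq b c) nef we pe => [<- nef we _|bc _ _].
    suff : (m.+1 <= m)%N by rewrite ltnn.
    apply: (mn m e' f') => //; first by move: nef; rewrite eqseq_cons eqxx.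
    by move: we; rewrite /milnor_word !big_cons => /mulgI.
  rewrite !p_cons sze szf; case: b c bc => [] [] //= _;
    rewrite expg0 expg1 conj1g mul1g => q.
    have -> : (y ^ (t ^+ m) = p f' * (p e')^-1)%g by rewrite -q mulgK.
    by apply: M => //; exact: V.
  have -> : (y ^ (t ^+ m) = p e' * (p f')^-1)%g by rewrite q mulgK.
  by apply: M => //; exact: V.
have bot : << conj_powers m >> (y ^ t^-1)%g.
  case/lastP: e' sze nef we pe => [//|e' b]; case/lastP: f' szf => [//|f' c].
  rewrite !size_rcons => -[szf] [sze] nef we pe.
  have pin := p_in e'; have qin := p_in f'; rewrite sze in pin; rewrite szf in qin.
  case: (eqVneq b c) nef we pe => [<- nef we _|bc _ _].
    suff : (m.+1 <= m)%N by rewrite ltnn.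
    apply: (mn m e' f') => //; first by move: nef; rewrite eqseq_rcons eqxx andbT.
    by move: we; rewrite /milnor_word -!cats1 !big_cat !big_seq1 => /mulIg.
  (* Conjugating the equality by [t^-1] turns the differing last letter into [y ^ t^-1]. *)
  rewrite !p_rcons; case: b c bc => [] [] //= _; rewrite expg0 expg1 mulg1 => q.
    have -> : (y ^ t^-1 = (p e')^-1 * p f')%g.
      rewrite -[RHS](conjgK t); congr (_ ^ _)%g.
    by rewrite conjMg -q conjVg mulKg.
    by apply: M => //; exact: V.
  have -> : (y ^ t^-1 = (p f')^-1 * p e')%g.
    rewrite -[RHS](conjgK t); congr (_ ^ _)%g.
    by rewrite conjMg q conjVg mulKg.
  by apply: M => //; exact: V.
(* Conjugation by [t] or [t^-1] shifts the index by one; [top] and [bot] cover the two ends of the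
   range. *)
have nt : normalises t (conj_powers m).
  move=> _ [i /= im <-]; split.
    rewrite -conjgM -expgSr.
    have [->//|] := eqVneq i.+1 m => ne.
    by apply: gen_sub; exists i.+1 => //=; rewrite ltn_neqAle ne.
  case: i im => [|i] im; first by rewrite expg0 conjg1.
  rewrite expgSr conjgM conjgK.
  by apply: gen_sub; exists i => //=; exact: ltnW.
(* [y] is obtained from [bot] and not as the generator of index 0, since [m] may be 0. *)
by split=> //; rewrite -(conjgKV t y); exact: normalisesJ.
Qed.

Lemma finite_conj_powers m : finite_set (conj_powers m).
Proof. by apply: finite_image; exact: finite_II. Qed.

End Milnor.

Lemma finite_letters (G : groupType) (A : set G) :
  finite_set A -> finite_set (letters A).
Proof. by move=> finA; rewrite finite_setU; split=> //; exact: finite_image. Qed.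

(** * Integer powers of an element *)

Section IntegerPower.
Context {G : groupType} (t : G).

Definition zpow (z : int) : G :=
  if z is Negz n then (t ^- n.+1)%g else (t ^+ `|z|%N)%g.

Lemma zpow_nat (n : nat) : zpow n = (t ^+ n)%g. Proof. by []. Qed.
Lemma zpow_natN (n : nat) : zpow (- n%:Z) = (t ^- n)%g.
Proof. by case: n => [|n]; rewrite ?expg0 ?invg1 // -NegzE. Qed.

Lemma zpowD1 z : zpow (z + 1) = (zpow z * t)%g.
Proof.
case: z => n; first by rewrite -PoszD !zpow_nat addn1 expgSr.
rewrite NegzE zpow_natN -addn1 PoszD opprD -addrA addNr addr0 zpow_natN addn1.
by rewrite expgS invgM mulgVK.
Qed.

Lemma zpowB1 z : zpow (z - 1) = (zpow z * t^-1)%g.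
Proof. by rewrite -[in RHS](subrK 1 z) zpowD1 mulgK. Qed.

Lemma zpowD z w : zpow (z + w) = (zpow z * zpow w)%g.
Proof.
elim/int_rec: w => [|n IH|n IH]; first by rewrite addr0 zpow_nat expg0 mulg1.
  by rewrite -addn1 PoszD addrA !zpowD1 IH mulgA.
by rewrite -addn1 PoszD opprD addrA !zpowB1 IH mulgA.
Qed.

Lemma zpowN z : zpow (- z) = (zpow z)^-1%g.
Proof. by apply: (@mulIg _ (zpow z)); rewrite -zpowD addNr mulVg zpow_nat expg0. Qed.

Lemma normalises_zpow B z x : normalises t B -> generated_subgroup B x ->
  generated_subgroup B (x ^ zpow z)%g.
Proof.
move=> nB; elim/int_rec: z x => [|n IH|n IH] x Bx.
- by rewrite zpow_nat expg0 conjg1.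
- by rewrite -addn1 PoszD zpowD1 conjgM; apply: normalisesJ => //; exact: IH.
- by rewrite -addn1 PoszD opprD zpowB1 conjgM; apply: normalisesJV => //; exact: IH.
Qed.
End IntegerPower.

(** * Homomorphisms to the integers and their kernels *)

Section Kernel.
Context {G : groupType} (chi : G -> int).
Hypothesis chiM : {morph chi : x y / (x * y)%g >-> x + y}.

Lemma chi1 : chi 1%g = 0.
Proof. by apply: (addrI (chi 1%g)); rewrite -chiM mulg1 addr0. Qed.

Lemma chiV x : chi x^-1%g = - chi x.
Proof. by apply: (addrI (chi x)); rewrite -chiM mulgV chi1 subrr. Qed.

Lemma chiJ x y : chi (x ^ y)%g = chi x.
Proof. by rewrite conjgE !chiM chiV addrCA addNr addr0. Qed.

Lemma chiR x y : chi [~ x, y]%g = 0.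
Proof. by rewrite commgEl chiM chiV chiJ addNr. Qed.

Lemma chi_zpow t z : chi (zpow t z) = z * chi t.
Proof.
elim/int_rec: z => [|n IH|n IH]; first by rewrite zpow_nat expg0 chi1 mul0r.
  by rewrite -addn1 PoszD zpowD1 chiM IH mulrDl mul1r.
by rewrite -addn1 PoszD opprD zpowB1 chiM chiV IH mulrBl mul1r.
Qed.

Lemma ker_subgroup : is_subgroup (chi @^-1` [set 0]).
Proof.
split=> [|x y /= x0 y0|x /= x0]; first exact: chi1.
  by rewrite chiM x0 y0.
by rewrite chiV x0 oppr0.
Qed.

(** * Schreier generators and finite generation of the kernel *)

Section Schreier.
Variables (A : set G) (t : G).
Hypotheses (Afin : finite_set A) (Agen : generated_subgroup A = [set: G]).
Hypotheses (chi_surj : forall z : int, exists x : G, chi x = z).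
Hypothesis (t0 : chi t != 0).

(** Schreier generators [s z a] with [z] in one residue class modulo [chi t] are conjugate under
    powers of [t], so finitely many suffice. Quantifying over [B] lets [C] be enlarged to a set
    normalised by [t]. *)
Lemma schreier : exists C : set G, [/\ finite_set C, C `<=` chi @^-1` [set 0] &
  forall B, B `<=` chi @^-1` [set 0] -> C `<=` B -> normalises t B ->
    generated_subgroup B = chi @^-1` [set 0]].
Proof.
have [r0 r0E] := choice chi_surj.
pose d := chi t; have d0 : d != 0 := t0.
(* r is a section of chi, equivariant under chi t: this makes s z a, up to
   conjugation by a power of t, depend only on z modulo chi t. *)
pose r z := (zpow t (z %/ d)%Z * r0 (z %% d)%Z)%g.
have chir z : chi (r z) = z by rewrite chiM chi_zpow r0E -divz_eq.
have rshift i z : r (i * d + z) = (zpow t i * r z)%g.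
  by rewrite /r divzMDl// modzMDl zpowD mulgA.
pose s z a := (r z * a * (r (z + chi a))^-1)%g.
(* [r 0] is included because the chosen preimage of 0 need not be the identity. *)
pose C := r 0 |` [set s z a | z in [set (n : int) | n in `I_`|d|%N] & a in letters A].
exists C; split.
- rewrite finite_setU; split; first exact: finite_set1.
  apply: finite_image2; last exact: finite_letters.
  by apply: finite_image; exact: finite_II.
- move=> _ [->|[z _ [a _ <-]]] /=; first by rewrite chir.
  by rewrite /s chiM chiV chiM !chir subrr.
move=> B Bker CB nB; have [B1 M V] := gen_subgroup B.
apply/seteqP; split; first exact: gen_min ker_subgroup Bker.
have sB z a : letters A a -> generated_subgroup B (s z a).
  move=> La; have -> : s z a = (s (z %% d)%Z a ^ zpow t (- (z %/ d)%Z))%g.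
    rewrite /s {1 2}(divz_eq z d) -addrA !rshift conjgE zpowN invgK.
    by rewrite invgM !mulgA.
  apply: normalises_zpow => //; apply: gen_sub; apply: CB; right.
  exists (z %% d)%Z; last by exists a.
  exists `|(z %% d)%Z|%N => /=; last by rewrite gez0_abs// modz_ge0.
  by rewrite -ltz_nat gez0_abs ?modz_ge0// ltz_mod.
(* Schreier rewriting: a letter [a] read after [u] contributes the factor [s (chi u) a], and the
   representatives telescope. *)
have rB x : generated_subgroup B (x * (r (chi x))^-1)%g.
  have : generated_subgroup A x by rewrite Agen.
  move=> [w [+ <-]]; elim/last_ind: w => [|w a IH] Lw.
    by rewrite big_nil mul1g chi1; apply: V; apply: gen_sub; apply: CB; left.
  rewrite -cats1 big_cat big_seq1 chiM /=.
  set u := (\prod_(i <- w) i)%g in IH *.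
  have -> : (u * a * (r (chi u + chi a))^-1 = (u * (r (chi u))^-1) * s (chi u) a)%g.
    by rewrite /s; move: (r _) (r _) => p q; rewrite !mulgA mulgVK.
  apply: M; last by apply: sB; apply: Lw; rewrite mem_rcons mem_head.
  by apply: IH => z zw; apply: Lw; rewrite mem_rcons inE zw orbT.
move=> x /= x0; rewrite -(mulgVK (r 0) x); apply: M; first by rewrite -x0.
by apply: gen_sub; apply: CB; left.
Qed.

Lemma ker_fg :
  (forall a, letters A a -> exists B, [/\ finite_set B, B `<=` chi @^-1` [set 0],
     normalises t B & generated_subgroup B [~ t, a]%g]) ->
  finitely_generated (chi @^-1` [set 0]).
Proof.
move=> HB.
have /choice[B {}HB] : forall a, exists B, letters A a -> [/\ finite_set B,
    B `<=` chi @^-1` [set 0], normalises t B & generated_subgroup B [~ t, a]%g].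
  by move=> a; case: (pselect (letters A a)) => [/HB[B ?]|?]; [exists B|exists set0].
(* These properties survive adjoining the conjugates of [M] by a letter, so they can be carried
   along a word. *)
pose good (M : set G) := [/\ finite_set M, M `<=` chi @^-1` [set 0], normalises t M &
  forall a, letters A a -> generated_subgroup M [~ t, a]%g].
have good0 : good (\bigcup_(a in letters A) B a).
  split.
  - by apply: bigcup_finite => [|a /HB[]//]; exact: finite_letters.
  - by move=> x [a /HB[_ + _ _]]; exact.
  - by apply: normalises_bigcup => a /HB[].
  - by move=> a La; have [_ _ _] := HB a La; apply: gen_mono => b Bb; exists a.
have goodJ M a : good M -> letters A a -> good (M `|` [set b ^ a | b in M]%g).
  move=> [Mfin Mker nM tM] La; split.
  - by rewrite finite_setU; split=> //; exact: finite_image.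
  - by move=> x [/Mker//|[b /Mker b0 <-]]; rewrite /= chiJ.
  - by apply: normalises_conj => //; exact: tM.
  - by move=> b /tM; apply: gen_mono; exact: subsetUl.
have good_word x : exists M, good M /\ generated_subgroup M [~ t, x]%g.
  have : generated_subgroup A x by rewrite Agen.
  move=> [w [+ <-]]; elim/last_ind: w => [|w a IH] Lw.
    exists (\bigcup_(a in letters A) B a); split=> //; rewrite big_nil commg1.
    by case: (gen_subgroup (\bigcup_(a in letters A) B a)).
  have La : letters A a by apply: Lw; rewrite mem_rcons mem_head.
  have [|M [gM Mw]] := IH.
    by move=> z zw; apply: Lw; rewrite mem_rcons inE zw orbT.
  exists (M `|` [set b ^ a | b in M]%g); split; first exact: goodJ.
  have [_ _ _ tMa] := goodJ _ _ gM La.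
  have [_ mulM _] := gen_subgroup (M `|` [set b ^ a | b in M]%g).
  rewrite -cats1 big_cat big_seq1 /=; set u := (\prod_(i <- w) i)%g in Mw *.
  (* The first factor is covered by [good], the second by the conjugates just adjoined. *)
  have -> : [~ t, u * a]%g = ([~ t, a] * [~ t, u] ^ a)%g.
    have tu : (t ^ u = t * [~ t, u])%g by rewrite commgEl mulVKg.
    by rewrite (commgEl t (u * a)) conjgM tu (conjMg t) mulgA -commgEl.
  apply: mulM; first exact: tMa.
  by apply: gen_image_conj Mw => b Mb; apply: gen_sub; right; exists b.
have [C [Cfin Cker Cgen]] := schreier.
have [M HM] := choice good_word.
exists ((\bigcup_(c in C) M c) `|` C); split.
  rewrite finite_setU; split=> //.
  by apply: bigcup_finite => // c _; have [[]] := HM c.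
apply: Cgen.
- by move=> x [[c _]|/Cker//]; have [[_ + _ _] _] := HM c; exact.
- exact: subsetUr.
(* Each [c] in [C] commutes with [t] modulo the group generated by [M c]. *)
- apply: normalises_adjoin.
    by apply: normalises_bigcup => c _; have [[]] := HM c.
  move=> c Cc; have [_] := HM c.
  by apply: gen_mono => x ?; exists c.
Qed.
End Schreier.
End Kernel.

(** * Word balls and their cardinalities *)

Section Growth.
Context {G : groupType} (A : set G).
Hypothesis Afin : finite_set A.

Lemma word_ballM m n x y :
  word_ball A m x -> word_ball A n y -> word_ball A (m + n) (x * y)%g.
Proof.
move=> [s [[Ls <-] sm]] [s' [[Ls' <-] sn]]; exists (s ++ s').
split; last by rewrite size_cat leq_add.
by split=> [z|]; rewrite ?big_cat// mem_cat => /orP[/Ls|/Ls'].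
Qed.

Lemma word_ball1 n : word_ball A n 1%g.
Proof. by exists [::]; split=> //; split=> //; rewrite big_nil. Qed.

Lemma word_ball_letter a : letters A a -> word_ball A 1 a.
Proof.
move=> La; exists [:: a]; split=> //; split=> [z|]; rewrite ?big_seq1//.
by rewrite inE => /eqP->.
Qed.

Lemma lettersV a : letters A a -> letters A a^-1%g.
Proof. by case=> [?|[b Ab <-]]; [right; exists a|left; rewrite invgK]. Qed.

Lemma growth_gt0 n : (0 < growth A n)%N.
Proof.
rewrite cardfs_gt0; apply/fset0Pn; exists 1%g.
by rewrite in_fset_set ?inE; [exact: word_ball1|exact: word_ball_finite].
Qed.

Lemma growth_mono m n : (m <= n)%N -> (growth A m <= growth A n)%N.
Proof.
move=> mn; apply: fsubset_leq_card; rewrite -fset_set_sub;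
  [|exact: word_ball_finite..].
by move=> x [s [sx sm]]; exists s; split=> //; exact: leq_trans mn.
Qed.

Lemma growthM m n : (growth A (m + n) <= growth A m * growth A n)%N.
Proof.
have fb k := word_ball_finite k Afin.
rewrite /growth -(size_allpairs (fun x y => x * y)%g).
apply: uniq_leq_size (fset_uniq _) _ => x.
rewrite in_fset_set// inE => -[s [[Ls <-] ss]]; apply/allpairsP.
exists (\prod_(y <- take m s) y, \prod_(y <- drop m s) y)%g => /=.
split; last by rewrite -big_cat cat_take_drop.
- rewrite in_fset_set// inE; exists (take m s); split.
    by split=> // z /mem_take/Ls.
  by rewrite size_take_min geq_minl.
- rewrite in_fset_set// inE; exists (drop m s); split.
    by split=> // z /mem_drop/Ls.
  by rewrite size_drop leq_subLR.
Qed.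

Lemma growth_free (I : finType) (f : I -> G) n : injective f ->
  (forall i, word_ball A n (f i)) -> (#|I| <= growth A n)%N.
Proof.
move=> finj fn.
have -> : #|I| = #|` [fset f i | i in I]%fset|.
  by rewrite card_imfset// cardE.
apply: fsubset_leq_card; apply/fsubsetP => _ /imfsetP[i _ ->].
by rewrite in_fset_set ?inE//; exact: word_ball_finite.
Qed.

(** Each letter of such a word is [t] or [a^-1 * t * a], hence of length at most 3. *)
Lemma growth_milnor (t a : G) : letters A t -> letters A a ->
  (forall e f, size e = size f ->
    milnor_word t [~ t, a]%g e = milnor_word t [~ t, a]%g f -> e = f) ->
  forall n, (2 ^ n <= growth A (3 * n))%N.
Proof.
move=> Lt La inj n.
have -> : (2 ^ n = #|{: n.-tuple bool}|)%N by rewrite card_tuple card_bool.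
apply: (growth_free
  (f := fun e : n.-tuple bool => milnor_word t [~ t, a]%g e)).
  by move=> e f /inj ef; apply: val_inj; apply: ef; rewrite !size_tuple.
move=> [e /= /eqP <-]; rewrite /milnor_word.
elim: e => [|b e IH]; first by rewrite big_nil; exact: word_ball1.
rewrite big_cons mulnS; apply: word_ballM IH.
have bt := word_ball_letter Lt; have ba := word_ball_letter La.
case: b => /=; last first.
  rewrite expg0 mulg1 -[t]mulg1.
  by apply: (@word_ballM 1 2) => //; exact: word_ball1.
rewrite expg1 commgEl mulVKg conjgE.
apply: (@word_ballM 1 2); first by apply: word_ball_letter; exact: lettersV.
exact: (@word_ballM 1 1).
Qed.
End Growth.

(** * Fekete's lemma and lower bounds for the growth rate *)

Lemma subadditive_mulDn (R : numDomainType) (a : nat -> R) :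
  (forall m n, a (m + n)%N <= a m + a n) ->
  forall m q r, a (q * m + r)%N <= a m *+ q + a r.
Proof.
move=> sub m; elim=> [|q IH] r; first by rewrite mul0n add0n mulr0n add0r.
rewrite mulSn -addnA mulrS -addrA.
by apply: le_trans (sub _ _) _; rewrite lerD2l.
Qed.

(** The limit is the infimum of the quotients: pick [m] nearly attaining it and divide [n] by [m];
    the remainder contributes a bounded term. *)
Lemma fekete (R : realType) (a : nat -> R) :
  (forall n, 0 <= a n) -> (forall m n, a (m + n)%N <= a m + a n) ->
  cvgn (fun n => a n / n%:R).
Proof.
move=> a0 sub.
(* Index 0 is excluded: its quotient is 0 by convention and would force the infimum to be 0. *)
pose E := [set a n / n%:R | n in [set n | (0 < n)%N]].
have Elb : lbound E 0 by move=> _ [n _ <-]; rewrite divr_ge0.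
have Einf : has_inf E by split; [exists (a 1%N / 1), 1%N|exists 0].
apply/cvg_ex; exists (inf E); apply/cvgrPdist_le => /= e e0.
have e20 : 0 < e / 2 by rewrite divr_gt0.
have [_ [m /= m0 <-] mE] := inf_adherent e20 Einf.
(* As all terms are nonnegative, this sum bounds [a r] for every remainder [r]. *)
pose C := \sum_(r < m) a r.
have aC r : (r < m)%N -> a r <= C.
  move=> rm; rewrite /C (bigD1 (Ordinal rm))//= lerDl.
  by apply: sumr_ge0.
near=> n.
have n0 : (0 < n)%N by near: n; exact: nbhs_infty_gt.
have nR : 0 < n%:R :> R by rewrite ltr0n.
have mR : 0 < m%:R :> R by rewrite ltr0n.
have lo : inf E <= a n / n%:R by apply: ge_inf; [exists 0|exists n].
rewrite distrC ger0_norm ?subr_ge0// lerBlDl.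
have Cn : C <= e / 2 * n%:R.
  rewrite mulrC -ler_pdivrMr//; near: n; exact: nbhs_infty_ger.
have := subadditive_mulDn sub m (n %/ m)%N (n %% m)%N; rewrite -divn_eq => an.
have am : a m < (inf E + e / 2) * m%:R by rewrite -ltr_pdivrMr.
rewrite ler_pdivrMr// (le_trans an)//.
have := aC _ (ltn_pmod n m0) => aC'.
have : a m *+ (n %/ m) <= (inf E + e / 2) * n%:R.
  apply: (@le_trans _ _ ((inf E + e / 2) * (n %/ m * m)%:R)).
    by rewrite -[leLHS]mulr_natr natrM mulrA mulrAC ler_wpM2r// ltW.
  rewrite ler_wpM2l ?ler_nat ?leq_divM//.
  by apply: le_trans (ltW mE); rewrite divr_ge0.
move=> am'.
have -> : (inf E + e) * n%:R = (inf E + e / 2) * n%:R + e / 2 * n%:R by field.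
by apply: lerD => //; exact: le_trans Cn.
Unshelve. all: by end_near.
Qed.

(** Logarithms turn submultiplicativity into subadditivity; Fekete's lemma and continuity of [expR]
    conclude. *)
Lemma growth_rate_cvg (R : realType) (G : groupType) (A : set G) : finite_set A ->
  cvgn (fun n : nat => (growth A n)%:R `^ (n%:R^-1) : R).
Proof.
move=> Afin; have g0 n : 0 < (growth A n)%:R :> R by rewrite ltr0n growth_gt0.
have -> : (fun n : nat => (growth A n)%:R `^ (n%:R^-1) : R) =
    expR \o (fun n => ln (growth A n)%:R / n%:R).
  by apply/funext => n; rewrite /powR gt_eqF//= mulrC.
have /cvg_ex[l cl] : cvgn (fun n => ln (growth A n)%:R / n%:R : R).
  apply: (@fekete R (fun n => ln (growth A n)%:R)) => [n|m n].
    by rewrite ln_ge0// ler1n growth_gt0.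
  rewrite -lnM ?posrE// ler_ln ?posrE// ?mulr_gt0// -natrM ler_nat.
  exact: growthM.
apply/cvg_ex; exists (expR l); apply: continuous_cvg cl.
exact: continuous_expR.
Qed.

Lemma growth_rate_ge (R : realType) (G : groupType) (A : set G) : finite_set A ->
  (forall n, (2 ^ n <= growth A (3 * n))%N) -> 2 `^ (1 / 4) <= growth_rate R A.
Proof.
move=> Afin big; apply: limr_ge; first exact: growth_rate_cvg.
(* The gap between exponents 1/3 and 1/4 absorbs rounding: [n <= 4 * (n %/ 3)] holds from 6 on and
   fails at 5. *)
near=> n; have n6 : (6 <= n)%N by near: n; exact: nbhs_infty_ge.
have nR : 0 < n%:R :> R by rewrite ltr0n; lia.
have -> : 1 / 4 = (n%:R / 4) * n%:R^-1 :> R by field; rewrite gt_eqF.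
rewrite powRrM; apply: ge0_ler_powR; rewrite ?nnegrE ?powR_ge0 ?invr_ge0 ?ler0n//.
apply: (@le_trans _ _ (2 `^ (n %/ 3)%:R)).
  apply: ler_powR; first by rewrite ler1n.
  rewrite ler_pdivrMr// -(natrM _ _ 4) ler_nat.
  by lia.
rewrite powR_mulrn// -natrX ler_nat (leq_trans (big _))// growth_mono//.
by lia.
Unshelve. all: by end_near.
Qed.

Theorem proposition2p4 (R : realType) (G : groupType) (chi : G -> int)
  (G_fg : finitely_generated [set: G])
  (chiM : {morph chi : x y / (x * y)%g >-> x + y})
  (chi_surj : forall z : int, exists x : G, chi x = z)
  (ker_nfg : ~ finitely_generated (chi @^-1` [set 0])) :
  2 `^ (1 / 4) <= growth_constant R G.
Proof.
(* Nonemptiness must be shown too, as the infimum of the empty set is a default value; [G_fg]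
   provides it. *)
apply: lb_le_inf.
  by have [A [Afin Agen]] := G_fg; exists (growth_rate R A), A.
move=> _ [A [Afin Agen] <-]; apply: growth_rate_ge => //.
have [t [At t0]] : exists t, letters A t /\ chi t != 0.
  apply: contrapT => nA; have [x x1] := chi_surj 1.
  have Ax : generated_subgroup A x -> chi x = 0.
    apply: (gen_min (H := chi @^-1` [set 0])) (ker_subgroup chiM) _ _ => t At.
    apply: contrapT => /eqP t0.
    by apply: nA; exists t; split=> //; left.
  by move: x1; rewrite Ax ?Agen.
(* If the growth bound fails, every letter [a] yields a coincidence, and Milnor's lemma supplies the
   sets required by [ker_fg]. *)
apply: contrapT => small; apply: ker_nfg.
apply: (ker_fg chiM Afin Agen chi_surj t0) => a La.
have [e [f [sz w ef]]] : exists e f, [/\ size e = size f,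
    milnor_word t [~ t, a]%g e = milnor_word t [~ t, a]%g f & e != f].
  apply: contrapT => inj; apply: small; apply: growth_milnor At La _ => // e f sz w.
  by apply: contrapT => /eqP ef; apply: inj; exists e, f.
have [m [nt my]] := milnor_normal ef sz w.
exists (conj_powers t [~ t, a]%g m); split=> //; first exact: finite_conj_powers.
by move=> _ [i _ <-]; rewrite /= chiJ// chiR.
Qed.
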